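(* Let $X$ be a real Hilbert space and let $A\colon X\rightrightarrows X$ be maximally monotone and uniformly monotone. Then the following hold. (i) $A$ satisfies the growth condition $$\lim_{\|x-y\|\to\infty}\ \inf_{(x,x^* )\in\operatorname{gra}A,\ (y,y^* )\in\operatorname{gra}A}\frac{\|x^*-y^*\|}{\|x-y\|}>0,$$ i.e., there exist $c>0$ and $K>0$ such that $\|x^*-y^*\|\ge c\|x-y\|$ for all $(x,x^* ),(y,y^* )\in\operatorname{gra}A$ with $\|x-y\|\ge K$. (ii) $A$ is surjective. (iii) $A$ has a unique zero. (iv) $A^{-1}$ is uniformly continuous.
   Context: For $A\colon X\rightrightarrows X$, $\operatorname{gra}A=\{(x,x^* )\in X\times X : x^*\in Ax\}$. A modulus is an increasing (nondecreasing) function $\phi\colon[0,\infty)\to[0,+\infty]$ that vanishes only at $0$. $A$ is uniformly monotone if there is a modulus $\phi$ such that $\langle x-y,x^*-y^*\rangle\ge\phi(\|x-y\|)$ for all $(x,x^* ),(y,y^* )\in\operatorname{gra}A$. $A$ is surjective if $\bigcup_{x\in X}Ax=X$. A zero of $A$ is an $x\in X$ with $0\in Ax$. $A^{-1}$ is the inverse operator, $x\in A^{-1}x^*\Leftrightarrow x^*\in Ax$; saying that it is uniformly continuous means it is single-valued, defined on all of $X$, and uniformly continuous as a map $X\to X$. The infimum of the empty set is $+\infty$. *)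

(* Defs.v *)
From HB Require Import structures.
From mathcomp Require Import all_boot all_order all_algebra sesquilinear.
From mathcomp Require Import all_classical all_reals all_analysis.
Set Implicit Arguments.
Unset Strict Implicit.
Unset Printing Implicit Defensive.
Import Order.TTheory GRing.Theory Num.Theory.
Import numFieldNormedType.Exports.
Local Open Scope classical_set_scope.
Local Open Scope ring_scope.

(* A real Hilbert space is a complete normed module [X] over [R : realType]
   together with an inner product [dot : {dot X for idfun}] (a symmetric
   positive definite bilinear form) inducing the norm of [X]. *)
Definition induces_norm (R : realType) (X : completeNormedModType R)
    (dot : {dot X for idfun}) : Prop :=
  forall x : X, `|x| = Num.sqrt (dot x x).

Section Operators.
Context {R : realType} {X : completeNormedModType R}.
Implicit Types (dot : {dot X for idfun}) (A B : X -> set X).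

Definition gra A : set (X * X) := [set p | A p.1 p.2].

Definition monotone_op dot A : Prop :=
  forall p q, gra A p -> gra A q -> 0 <= dot (p.1 - q.1) (p.2 - q.2).

Definition maximally_monotone dot A : Prop :=
  monotone_op dot A /\
  forall B, monotone_op dot B -> gra A `<=` gra B -> gra B = gra A.

(* A modulus is a function on [0, +oo[; its values at negative reals are
   irrelevant. *)
Definition modulus (phi : R -> \bar R) : Prop :=
  [/\ forall t : R, 0 <= t -> (0 <= phi t)%E,
      forall s t : R, 0 <= s -> s <= t -> (phi s <= phi t)%E
    & forall t : R, 0 <= t -> (phi t = 0%E <-> t = 0)].

Definition uniformly_monotone dot A : Prop :=
  exists2 phi : R -> \bar R, modulus phi &
    forall p q, gra A p -> gra A q ->
      (phi `|p.1 - q.1|%R <= (dot (p.1 - q.1)%R (p.2 - q.2)%R)%:E)%E.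

Definition surjective_op A : Prop := \bigcup_x A x = setT.

Definition zero_of A (x : X) : Prop := A x 0.

Definition inverse_op A : X -> set X := fun u => [set x | A x u].

Definition uniformly_continuous_op A : Prop :=
  exists2 T : X -> X, (forall x, A x = [set T x]) & unif_continuous T.

(* [ereal_inf set0 = +oo]. For K > 0 no denominator vanishes. *)
Definition growth_inf A (K : R) : \bar R :=
  ereal_inf [set (`|pq.1.2 - pq.2.2| / `|pq.1.1 - pq.2.1|)%:E
            | pq in [set pq | [/\ gra A pq.1, gra A pq.2
                                & K <= `|pq.1.1 - pq.2.1|]]].

(* The infimum for |x - y| --> +oo is that over the pairs with
   |x - y| >= K, as K --> +oo. *)
Definition growth_limit A : Prop :=
  exists2 l : \bar R, growth_inf A K @[K --> +oo] --> l & (0 < l)%E.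

Definition growth_bound A : Prop :=
  exists c K : R, [/\ 0 < c, 0 < K &
    forall p q, gra A p -> gra A q -> K <= `|p.1 - q.1| ->
      c * `|p.1 - q.1| <= `|p.2 - q.2|].

End Operators.

(* Main.v *)
(* Minty's theorem gives, for every l > 0, an everywhere defined resolvent
   F_l = (A + l)^-1.  Moving along a segment and using the intermediate value
   theorem, uniform monotonicity makes the F_l uniformly continuous, with a
   modulus of continuity independent of l, hence Lipschitz for large distances,
   and therefore bounded at each point as l -> 0.  Uniform monotonicity then
   makes F_l v Cauchy as l -> 0, and its limit solves A x = v.  The modulus
   passes to A^-1, and the large-scale Lipschitz bound for A^-1 is the growth
   condition for A. *)
Require Import Defs.
From mathcomp Require Import all_boot all_order all_algebra sesquilinear.
From mathcomp Require Import all_classical all_reals all_analysis.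
From mathcomp Require Import ring lra.
Import Order.TTheory GRing.Theory Num.Theory.
Import numFieldNormedType.Exports.
Local Open Scope classical_set_scope.
Local Open Scope ring_scope.

(** * Cauchy sequences and elementary estimates *)

Lemma cauchy_seq_cvg (R : realType) (X : completeNormedModType R)
    (u : nat -> X) :
  (forall e : R, 0 < e ->
     exists N, forall n k, (N <= n)%N -> (N <= k)%N -> `|u n - u k| <= e) ->
  cvg (u @ \oo).
Proof.
move=> H; apply: cauchy_cvg; apply: cauchy_exP => e e0.
have e20 : 0 < e / 2 by rewrite divr_gt0.
have [N HN] := H _ e20.
exists (u N), N => // n /= Nn; rewrite -ball_normE /=.
by apply: le_lt_trans (HN N n (leqnn N) Nn) _; lra.
Qed.

Lemma invS_lt_near (R : realType) (e : R) : 0 < e ->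
  exists N, forall n, (N <= n)%N -> n.+1%:R^-1 < e.
Proof.
move=> e0; have [N _ HN] := near_infty_natSinv_lt (PosNum e0).
by exists N => n Nn; exact: (HN n Nn).
Qed.

Lemma ge0_of_add_small_mul (R : realType) (a b : R) :
  (forall t, 0 < t -> t <= 1 -> 0 <= a + t * b) -> 0 <= a.
Proof.
move=> H; rewrite leNgt; apply/negP => a0.
have b1 : 0 < `|b| + 1 by rewrite ltr_wpDl.
pose t := Num.min 1 (- a / 2 / (`|b| + 1)).
have t0 : 0 < t by rewrite lt_min ltr01 !divr_gt0 ?oppr_gt0.
have t1 : t <= 1 by rewrite ge_min lexx.
have := H t t0 t1.
have : t * (`|b| + 1) <= - a / 2.
  by rewrite -ler_pdivlMr // ge_min lexx orbT.
have : t * b <= t * `|b| by rewrite ler_pM2l // ler_norm.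
by lra.
Qed.

(** Cut the segment from [v] to [w] into [floor(|v - w| / d) + 1] equal pieces: each is shorter than
    [d], so [f] moves by at most [e] along each. *)
Lemma unif_cont_large_scale (R : realType) (X Y : normedModType R)
    (f : X -> Y) (e d : R) : 0 <= e -> 0 < d ->
  (forall v w, `|v - w| < d -> `|f v - f w| <= e) ->
  forall v w, `|f v - f w| <= e * (`|v - w| / d + 1).
Proof.
move=> e0 d0 fd v w.
suff chain n : forall v w, `|v - w| < n.+1%:R * d ->
    `|f v - f w| <= n.+1%:R * e.
  have /andP[N1 N2] := truncn_itv (divr_ge0 (normr_ge0 (v - w)) (ltW d0)).
  set N := Num.truncn _ in N1 N2.
  apply: le_trans (chain N _ _ _) _; first by rewrite -ltr_pdivrMr.
  by rewrite mulrC ler_wpM2l// -natr1 lerD2r.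
elim: n => [v' w'|n IHn v' w' vw]; first by rewrite !mul1r => /fd.
pose t : R := n.+2%:R^-1.
have t0 : 0 < t by rewrite invr_gt0.
have tn : n.+1%:R = t^-1 - 1 :> R by rewrite /t invrK -(natr1 n.+1) addrK.
have tn2 : n.+2%:R = t^-1 :> R by rewrite /t invrK.
have t1 : 0 <= 1 - t by rewrite subr_ge0 invf_le1// ler1n.
rewrite tn2 mulrC ltr_pdivlMr // in vw.
pose z := v' + t *: (w' - v').
have v'z : `|v' - z| < d.
  rewrite /z opprD addrA subrr add0r normrN normrZ gtr0_norm// distrC.
  by rewrite mulrC.
have zw' : `|z - w'| < n.+1%:R * d.
  have -> : z - w' = (1 - t) *: (v' - w').
    by rewrite /z scalerBl scale1r -[w' - v']opprB scalerN addrAC.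
  rewrite normrZ (ger0_norm t1) tn.
  have : (1 - t) * `|v' - w'| = (t^-1 - 1) * (`|v' - w'| * t).
    by field; rewrite gt_eqF.
  move=> ->; rewrite ltr_pM2l// -tn; exact: ltr0Sn.
have := IHn _ _ zw'; have := fd _ _ v'z.
have := ler_distD (f z) (f v') (f w').
rewrite -(natr1 n.+1) mulrDl mul1r; lra.
Qed.

(** * Inner product and Minty's theorem *)

Section InnerProduct.
Context {R : realType} {X : completeNormedModType R} {dot : {dot X for idfun}}.
Context (dot_norm : induces_norm dot).

Let dotC x y : dot x y = dot y x.
Proof. by rewrite (hermitian_subproof x y) expr0 mul1r. Qed.
Let dotDl x y z : dot (x + y) z = dot x z + dot y z.
Proof. exact: linearDl. Qed.
Let dotNl x z : dot (- x) z = - dot x z.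
Proof. exact: linearNl. Qed.
Let dotZl a x z : dot (a *: x) z = a * dot x z.
Proof. by rewrite linearZl_LR. Qed.
Let dotDr x y z : dot z (x + y) = dot z x + dot z y.
Proof. by rewrite dotC dotDl !(dotC z). Qed.
Let dotNr x z : dot z (- x) = - dot z x.
Proof. by rewrite dotC dotNl !(dotC z). Qed.
Let dotZr a x z : dot z (a *: x) = a * dot z x.
Proof. by rewrite dotC dotZl !(dotC z). Qed.
Let dotE := (dotDl, dotNl, dotZl, dotDr, dotNr, dotZr).

Lemma dotxx x : dot x x = `|x| ^+ 2.
Proof.
rewrite dot_norm sqr_sqrtr//; have [->|x0] := eqVneq x 0.
  by rewrite -[0 in leRHS](scale0r (0 : X)) dotZl mul0r.
by apply: ltW; apply: neq0_dnorm_gt0.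
Qed.

Lemma dotxx_ge0 x : 0 <= dot x x.
Proof. by rewrite dotxx sqr_ge0. Qed.

Lemma dotxx_le0 x : dot x x <= 0 -> x = 0.
Proof.
rewrite dotxx => H; apply/eqP; rewrite -normr_eq0 -sqrf_eq0.
by rewrite eq_le H sqr_ge0.
Qed.

Lemma dot_le_norm x y : dot x y <= `|x| * `|y|.
Proof.
have [->|x0] := eqVneq x 0.
  by rewrite -[0 in leLHS](scale0r (0 : X)) dotZl mul0r normr0 mul0r.
have [->|y0] := eqVneq y 0.
  by rewrite dotC -[0 in leLHS](scale0r (0 : X)) dotZl mul0r normr0 mulr0.
(* This square expands to [2 |x| |y| (|x| |y| - dot x y)]. *)
have : 0 <= dot (`|y| *: x - `|x| *: y) (`|y| *: x - `|x| *: y).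
  exact: dotxx_ge0.
rewrite !dotE (dotC y x) !dotxx => H.
have p : 0 < `|x| * `|y| by rewrite mulr_gt0 ?normr_gt0.
rewrite -(ler_pM2l p); nra.
Qed.

Lemma cvg_dot (u v : nat -> X) x y :
  u @ \oo --> x -> v @ \oo --> y ->
  (fun n => dot (u n) (v n)) @ \oo --> dot x y.
Proof.
move=> ux vy.
(* Polarization reduces the continuity of [dot] to that of the norm. *)
have E a b : dot a b = 4^-1 * (`|a + b| ^+ 2 - `|a - b| ^+ 2).
  by rewrite -!dotxx !dotE (dotC b a); field.
rewrite E; under eq_fun do rewrite E.
apply: cvgMr; apply: cvgB; rewrite expr2; under eq_fun do rewrite expr2.
  by apply: cvgM; apply: cvg_norm; apply: cvgD.
by apply: cvgM; apply: cvg_norm; apply: cvgB.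
Qed.

(* Fitzpatrick's argument: minimise r + (|x|^2 + |u|^2) / 2 over the epigraph of
   F_B(x, u) = sup_(b in B a) <x, b> + <a, u> - <a, b>.  Since F_B dominates the
   duality product, the optimality condition at the minimiser (x0, u0) says
   that (- u0, - x0) is monotonically related to B, and then u0 = - x0. *)
Lemma Minty_surj (B : X -> set X) :
  (forall x u y v, B x u -> B y v -> 0 <= dot (x - y) (u - v)) ->
  (forall x u, (forall y v, B y v -> 0 <= dot (x - y) (u - v)) -> B x u) ->
  exists x, B x (- x).
Proof.
move=> Bmono Bmax.
pose epi x u r := forall a b, B a b -> dot x b + dot a u - dot a b <= r.
have epi_ge x u r : epi x u r -> dot x u <= r.
  move=> xur; have [Bxu|nBxu] := pselect (B x u).
    by have := xur _ _ Bxu; rewrite addrK.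
  (* [dot (x - a) (u - b)] is [dot x u] minus the expression that [epi] bounds by [r], so
     [r < dot x u] would make [(x, u)] monotonically related to [B]. *)
  apply: contrapT => /negP; rewrite -ltNge => rlt; apply: nBxu.
  apply: Bmax => a b Bab; have := xur _ _ Bab.
  by rewrite !dotE; lra.
pose G x u r := r + 2^-1 * (dot x x + dot u u).
have G_ge0 x u r : epi x u r -> 0 <= G x u r.
  move=> /epi_ge; have := dotxx_ge0 (x + u).
  by rewrite /G !dotE (dotC u x); lra.
have [a0 [b0 B0]] : exists a b, B a b.
  apply: contrapT => NB.
  (* For an empty [B] the premise of [Bmax] is vacuous. *)
  have B00 : B 0 0 by apply: Bmax => a b Bab; exfalso; apply: NB; exists a, b.
  by apply: NB; exists 0, 0.
have epiB a b : B a b -> epi a b (dot a b).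
  move=> Bab c d Bcd; have := Bmono _ _ _ _ Bab Bcd.
  by rewrite !dotE; lra.
have epi_conv t x u r y v s : 0 <= t -> t <= 1 -> epi x u r -> epi y v s ->
    epi ((1 - t) *: x + t *: y) ((1 - t) *: u + t *: v) ((1 - t) * r + t * s).
  move=> t0 t1 xur yvs a b Bab; have := xur _ _ Bab; have := yvs _ _ Bab.
  by rewrite !dotE; nra.
pose S := [set g | exists x u r, epi x u r /\ g = G x u r].
have Sinf : has_inf S.
  split; last by exists 0 => _ [x [u [r [xur ->]]]]; apply: G_ge0.
  exists (G a0 b0 (dot a0 b0)), a0, b0, (dot a0 b0).
  by split => //; apply: epiB.
set m := inf S.
have m_le x u r : epi x u r -> m <= G x u r.
  by move=> xur; apply: ge_inf; [exact: Sinf.2 | exists x, u, r].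
have /choice[z Hz] : forall n : nat, exists z : X * X * R,
    epi z.1.1 z.1.2 z.2 /\ G z.1.1 z.1.2 z.2 < m + n.+1%:R^-1.
  move=> n; have n0 : 0 < n.+1%:R^-1 :> R by rewrite invr_gt0.
  have [g [x [u [r [xur ->]]]] gm] := inf_adherent n0 Sinf.
  by exists (x, u, r).
(* Strong convexity: at the midpoint [G] is the mean of the two values minus an eighth of the
   left-hand side, yet still at least [m]. *)
have zdist n k : `|(z n).1.1 - (z k).1.1| ^+ 2 + `|(z n).1.2 - (z k).1.2| ^+ 2
    <= 4 * (n.+1%:R^-1 + k.+1%:R^-1).
  have [en gn] := Hz n; have [ek gk] := Hz k.
  move: (z n) (z k) en gn ek gk => [[x u] r] [[y v] s] /= en gn ek gk.
  have h0 : 0 <= 2^-1 :> R by lra.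
  have h1 : 2^-1 <= 1 :> R by lra.
  have := m_le _ _ _ (epi_conv _ _ _ _ _ _ _ h0 h1 en ek).
  move: gn gk; rewrite /G -!dotxx !dotE (dotC y x) (dotC v u).
  move: (n.+1%:R^-1) (k.+1%:R^-1) => c d.
  lra.
have cauchy_z (f : X * X * R -> X) :
    (forall n k, `|f (z n) - f (z k)| ^+ 2 <= 4 * (n.+1%:R^-1 + k.+1%:R^-1)) ->
    cvg ((fun n => f (z n)) @ \oo).
  move=> fz; apply: cauchy_seq_cvg => e e0.
  have e20 : 0 < e ^+ 2 / 8 by rewrite divr_gt0 ?exprn_gt0.
  have [N HN] := invS_lt_near R _ e20.
  exists N => n k /HN Nn /HN Nk; rewrite -ler_sqr ?nnegrE ?(ltW e0)//.
  apply: le_trans (fz n k) _; move: Nn Nk.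
  by move: (n.+1%:R^-1) (k.+1%:R^-1) => c d; lra.
have /cvg_ex[x0 xx0] : cvg ((fun n => (z n).1.1) @ \oo).
  apply: (cauchy_z (fun z => z.1.1)) => n k.
  by apply: le_trans _ (zdist n k); rewrite lerDl sqr_ge0.
have /cvg_ex[u0 uu0] : cvg ((fun n => (z n).1.2) @ \oo).
  apply: (cauchy_z (fun z => z.1.2)) => n k.
  by apply: le_trans _ (zdist n k); rewrite lerDr sqr_ge0.
(* No limit of the third components of [z] is taken; [r0] is the value for which
   [G x0 u0 r0 = m]. *)
pose r0 := m - 2^-1 * (dot x0 x0 + dot u0 u0).
have epi0 : epi x0 u0 r0.
  move=> a b Bab.
  pose w n : R := dot (z n).1.1 b + dot a (z n).1.2 - dot a b
    + 2^-1 * (dot (z n).1.1 (z n).1.1 + dot (z n).1.2 (z n).1.2).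
  have wcvg : w @ \oo --> dot x0 b + dot a u0 - dot a b
      + 2^-1 * (dot x0 x0 + dot u0 u0).
    apply: cvgD; last by apply: cvgMr; apply: cvgD; apply: cvg_dot.
    apply: cvgB; last exact: cvg_cst.
    by apply: cvgD; apply: cvg_dot => //; exact: cvg_cst.
  rewrite /r0 lerBrDr; apply/ler_addgt0Pr => e e0.
  apply: (cvgr_to_le wcvg).
  have [N HN] := invS_lt_near R e e0.
  exists N => // n /= /HN ne; have [] := Hz n.
  move: ne => + /(_ _ _ Bab); rewrite /G /w; move: (n.+1%:R^-1) => c; lra.
have G0 : G x0 u0 r0 = m by rewrite /G /r0 subrK.
(* Compare [G] at the minimiser with its values on the segment towards [(a, b, dot a b)], divide by
   [t] and let [t] tend to 0. *)
have opt a b : B a b -> 0 <= dot a b - r0 + dot x0 (a - x0) + dot u0 (b - u0).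
  move=> Bab.
  pose q := dot (a - x0) (a - x0) + dot (b - u0) (b - u0).
  apply: (@ge0_of_add_small_mul _ _ (2^-1 * q)) => t t0 t1.
  have := m_le _ _ _ (epi_conv t _ _ _ _ _ _ (ltW t0) t1 epi0 (epiB _ _ Bab)).
  rewrite -G0 /G /q !dotE (dotC a x0) (dotC b u0) => H.
  rewrite -(pmulr_rge0 _ t0); lra.
(* Adding [dot x0 u0 <= r0] to [opt] gains the full square of [x0 + u0]; it vanishes once [(y, v)]
   is taken to be [(- u0, - x0)] itself. *)
have neg_mono y v : B y v ->
    dot (x0 + u0) (x0 + u0) <= dot (- u0 - y) (- x0 - v).
  move=> Byv; have := opt _ _ Byv; have := epi_ge _ _ _ epi0.
  by rewrite !dotE (dotC u0 x0) (dotC y x0); lra.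
have Bneg : B (- u0) (- x0).
  by apply: Bmax => y v /neg_mono; apply: le_trans; exact: dotxx_ge0.
have /eqP : x0 + u0 = 0.
  apply: dotxx_le0; apply: le_trans (neg_mono _ _ Bneg) _.
  by rewrite !dotE; lra.
rewrite addr_eq0 => /eqP x0E; exists x0.
by move: Bneg; rewrite -x0E.
Qed.

(** * Maximality and resolvents *)

Context {A : X -> set X} (Amax : maximally_monotone dot A).

Let A_mono x u y v : A x u -> A y v -> 0 <= dot (x - y) (u - v).
Proof. by move=> xu yv; exact: (Amax.1 (x, u) (y, v)). Qed.

(** Adjoining [(x, u)] keeps the graph monotone, so maximality absorbs the pair. *)
Lemma maximal_related x u :
  (forall y v, A y v -> 0 <= dot (x - y) (u - v)) -> A x u.
Proof.
move=> H; pose B y := [set v | A y v \/ (y = x /\ v = u)].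
have Bmono : monotone_op dot B.
  move=> [y v] [y' v']; rewrite /gra /= => -[yv|[-> ->]] [yv'|[-> ->]].
  - exact: A_mono.
  - by have := H _ _ yv; rewrite -(opprB y) dotNl -(opprB v) dotNr opprK.
  - exact: H.
  - by rewrite !subrr linear0r.
have AB : gra A `<=` gra B by move=> p; left.
have : gra B (x, u) by right.
by rewrite (Amax.2 _ Bmono AB).
Qed.

Lemma resolvent_exists l v : 0 < l -> exists x, A x (v - l *: x).
Proof.
move=> l0.
(* Minty's theorem is applied to the rescaled operator [l^-1 (A - v)]. *)
have [| |x Bx] := @Minty_surj (fun x => [set y | A x (v + l *: y)]).
- move=> x u y w /= /A_mono H /H.
  by rewrite opprD addrACA subrr add0r -scalerBr dotZr pmulr_rge0.
- move=> x u H /=; apply: maximal_related => y w yw.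
  have := H y (l^-1 *: (w - v)).
  rewrite /= scalerA divff ?gt_eqF// scale1r addrCA subrr addr0 => /(_ yw).
  rewrite -(pmulr_rge0 _ l0) -dotZr scalerBr scalerA divff ?gt_eqF// scale1r.
  by rewrite opprB addrA (addrC v).
by exists x; move: Bx; rewrite /= scalerN.
Qed.

Lemma maximal_closed (x u : nat -> X) x0 u0 : (forall n, A (x n) (u n)) ->
  x @ \oo --> x0 -> u @ \oo --> u0 -> A x0 u0.
Proof.
move=> xu xx0 uu0; apply: maximal_related => y v yv.
have c : (fun n => dot (x n - y) (u n - v)) @ \oo --> dot (x0 - y) (u0 - v).
  by apply: cvg_dot; apply: cvgB => //; exact: cvg_cst.
by apply: (cvgr_to_ge c); near do exact: A_mono.
Unshelve. all: by end_near.
Qed.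

(** * Uniform estimates for the resolvents and the inverse *)

Context (Aunif : uniformly_monotone dot A).

Lemma uniform_gap e : 0 < e -> exists2 d, 0 < d &
  forall x u y v, A x u -> A y v -> e <= `|x - y| -> d <= dot (x - y) (u - v).
Proof.
move=> e0; have [phi [phi0 phile phieq] phiA] := Aunif.
have pe : (0 < phi e)%E.
  rewrite lt_def phi0 ?ltW// andbT; apply/eqP => /phieq.
  by rewrite (ltW e0) => /(_ isT) E; move: e0; rewrite E ltxx.
have H x u y v : A x u -> A y v -> e <= `|x - y| ->
    (phi e <= (dot (x - y) (u - v))%:E)%E.
  move=> xu yv exy; apply: le_trans (phiA (x, u) (y, v) xu yv).
  by apply: phile => //; apply: ltW.
case: (phi e) pe H => [d| |] //= pe H.
- exists d; first by rewrite -lte_fin.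
  by move=> x u y v xu yv; rewrite -lee_fin; exact: H.
(* Here [phi e = +oo]: no two points of the domain are [e] apart, and any positive constant will
   do. *)
- by exists 1 => // x u y v xu yv /(H _ _ _ _ xu yv).
Qed.

(* The gap d only controls pairs at distance at least e; moving w towards v
   produces, by the intermediate value theorem, a pair at distance exactly e,
   which bounds |v - w| from below by d / e independently of l. *)
Lemma resolvent_unif_cont l (F : X -> X) e d v w : 0 < l ->
  (forall v, A (F v) (v - l *: F v)) -> 0 < e ->
  (forall x u y v, A x u -> A y v -> e <= `|x - y| ->
    d <= dot (x - y) (u - v)) ->
  e * `|v - w| < d -> `|F v - F w| <= e.
Proof.
move=> l0 FA e0 gap vw.
have Fdot a b : dot (F a - F b) (a - l *: F a - (b - l *: F b))
    = dot (F a - F b) (a - b) - l * `|F a - F b| ^+ 2.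
  by rewrite -dotxx !dotE (dotC (F b) (F a)); ring.
(* This constant blows up as [l] tends to 0; it only supplies the continuity needed for the
   intermediate value theorem. *)
have Flip a b : `|F a - F b| <= l^-1 * `|a - b|.
  have := A_mono _ _ _ _ (FA a) (FA b); rewrite Fdot.
  have := dot_le_norm (F a - F b) (a - b).
  have [->|n0] := eqVneq (`|F a - F b|) 0.
    by move=> _ _; rewrite mulr_ge0// invr_ge0 ltW.
  have p : 0 < `|F a - F b| by rewrite lt_def n0 normr_ge0.
  by move=> H1 H2; rewrite ler_pdivlMl// -(ler_pM2l p); lra.
have Fcont : continuous F.
  move=> x; apply/cvgrPdist_le => t t0; near=> y.
  apply: le_trans (Flip x y) _; rewrite ler_pdivrMl//.
  near: y; apply: (@cvgr_dist_le _ _ _ _ _ id) => //; exact: mulr_gt0.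
rewrite leNgt; apply/negP => eF.
pose g (s : R) := `|F v - F (v + s *: (w - v))|.
have gcont : continuous g.
  move=> s; apply: cvg_norm; apply: cvgB; first exact: cvg_cst.
  apply: (@cvg_comp _ _ _ (fun s => v + s *: (w - v)) F _ _ _ _ (Fcont _)).
  by apply: cvgD; [exact: cvg_cst | apply: cvgZr_tmp; exact: cvg_id].
have g0 : g 0 = 0 by rewrite /g scale0r addr0 subrr normr0.
have g1 : g 1 = `|F v - F w| by rewrite /g scale1r addrCA subrr addr0.
have [||s] := @IVT _ g 0 1 e ler01.
- exact: continuous_subspaceT.
- by rewrite g0 g1 ge_min (ltW e0) le_max (ltW eF) orbT.
rewrite in_itv/= => /andP[s0 s1] gs.
(* At distance exactly [e] the gap gives [d + l e^2 <= e s |v - w| <= e |v - w|], against the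
   hypothesis. *)
have := gap _ _ _ _ (FA v) (FA (v + s *: (w - v))).
rewrite -/(g s) gs lexx Fdot -/(g s) => /(_ isT).
have := dot_le_norm (F v - F (v + s *: (w - v))) (v - (v + s *: (w - v))).
rewrite -/(g s) gs opprD addrA subrr add0r normrN normrZ (ger0_norm s0) distrC.
have : s * `|v - w| <= `|v - w| by rewrite ler_piMl.
have : 0 <= l * e ^+ 2 by rewrite mulr_ge0 ?sqr_ge0 ?ltW.
by nra.
Unshelve. all: by end_near.
Qed.

Let A_unique l v x y : 0 < l -> A x (v - l *: x) -> A y (v - l *: y) -> x = y.
Proof.
move=> l0 xv yv; apply/eqP; rewrite -subr_eq0; apply/eqP; apply: dotxx_le0.
have := A_mono _ _ _ _ xv yv.
rewrite opprD addrACA subrr add0r -opprD -scalerBr dotNr dotZr.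
by rewrite oppr_ge0 pmulr_rle0.
Qed.

Let resolvent l : 0 < l -> exists F : X -> X, forall v, A (F v) (v - l *: F v).
Proof. by move=> l0; have /choice[F] := resolvent_exists l ^~ l0; exists F. Qed.

(** No limit in [l] is needed: [x] and [y] are the values of one resolvent at [u + l x] and
    [v + l y], and [l] is chosen so small that these points still satisfy the strict bound. *)
Lemma gap_close e d x u y v : 0 < e ->
  (forall x u y v, A x u -> A y v -> e <= `|x - y| ->
    d <= dot (x - y) (u - v)) ->
  A x u -> A y v -> e * `|u - v| < d -> `|x - y| <= e.
Proof.
move=> e0 gap xu yv uvd.
have n1 : 0 < `|x - y| + 1 by rewrite ltr_wpDl.
pose l := (d - e * `|u - v|) / (e * (`|x - y| + 1)).
have l0 : 0 < l by rewrite divr_gt0 ?subr_gt0 ?mulr_gt0.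
have [F FA] := resolvent l l0.
have FE z w : A z w -> F (w + l *: z) = z.
  by move=> zw; apply: (A_unique _ _ _ _ l0 (FA _)); rewrite addrK.
rewrite -(FE _ _ xu) -(FE _ _ yv).
apply: (resolvent_unif_cont _ _ _ _ _ _ l0 FA e0 gap).
rewrite opprD addrACA -scalerBr.
have /(ler_wpM2l (ltW e0)) := ler_normD (u - v) (l *: (x - y)).
rewrite normrZ (gtr0_norm l0).
have : e * (l * (`|x - y| + 1)) = d - e * `|u - v|.
  by rewrite mulrCA /l divfK// gt_eqF// mulr_gt0.
have : 0 < e * l by rewrite mulr_gt0.
lra.
Qed.

(** * Surjectivity and properties of the inverse *)

Lemma surjective_pointwise v : exists x, A x v.
Proof.
have [d d0 gap] := uniform_gap 1 ltr01.
have [a] := resolvent_exists 1 0 ltr01; set b := _ - _ => ab.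
pose l (n : nat) : R := harmonic n.
have l0 n : 0 < l n by exact: harmonic_gt0.
have l1 n : l n <= 1 by rewrite /l /= invf_le1// ler1n.
have /choice[x xA] n := resolvent_exists (l n) v (l0 n).
have [M M0 xM] : exists2 M, 0 < M & forall n, `|x n| <= M.
  exists ((`|v - b| + `|a|) / d + 1 + `|a|).
    by rewrite ltr_wpDr// ltr_wpDl// divr_ge0 ?(ltW d0)// addr_ge0.
  move=> n; have [F FA] := resolvent (l n) (l0 n).
  have -> : x n = F v by exact: (A_unique _ _ _ _ (l0 n)) (FA v).
  (* The graph point [(a, b)] anchors all resolvents: each takes the value [a] at a point within
     [|a|] of [b], since [l n <= 1]. *)
  have Fa : F (b + l n *: a) = a.
    by apply: (A_unique _ _ _ _ (l0 n) (FA _)); rewrite addrK.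
  have := unif_cont_large_scale _ _ _ F 1 d ler01 d0 _ v (b + l n *: a).
  rewrite Fa mul1r => /(_ _)H.
  have {}H : `|F v - a| <= `|v - (b + l n *: a)| / d + 1.
    apply: H => u w uw.
    apply: (resolvent_unif_cont _ _ _ _ _ _ (l0 n) FA ltr01 gap).
    by rewrite mul1r.
  have K : `|v - (b + l n *: a)| / d <= (`|v - b| + `|a|) / d.
    rewrite ler_pM2r ?invr_gt0// opprD addrA.
    rewrite (le_trans (ler_normB _ _))// lerD2l.
    by rewrite normrZ gtr0_norm// ler_piMl.
  have := ler_distD a (F v) 0; rewrite !subr0.
  by lra.
have /cvg_ex[x0 xx0] : cvg (x @ \oo).
  apply: cauchy_seq_cvg => e e0.
  have [c c0 egap] := uniform_gap e e0.
  have q0 : 0 < 4 * M ^+ 2 by rewrite mulr_gt0// exprn_gt0.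
  have [N HN] := invS_lt_near R (c / (4 * M ^+ 2)) (divr_gt0 c0 q0).
  (* A distance of at least [e] would give [c <= 2 M (l n + l k) M], but [l n] and [l k] are below
     [c / (4 M^2)]. *)
  exists N => n k /HN Nn /HN Nk; rewrite leNgt; apply/negP => /ltW ex.
  have := egap _ _ _ _ (xA n) (xA k) ex; apply/negP; rewrite -ltNge.
  apply: le_lt_trans (dot_le_norm _ _) _.
  have n1 : `|x n - x k| <= 2 * M.
    by have := ler_normB (x n) (x k); have := xM n; have := xM k; lra.
  have n2 : `|v - l n *: x n - (v - l k *: x k)| <= (l n + l k) * M.
    rewrite opprD addrACA subrr add0r -opprD normrN.
    apply: le_trans (ler_normB _ _) _; rewrite !normrZ !gtr0_norm//.
    by rewrite mulrDl lerD// ler_wpM2l// ltW.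
  apply: le_lt_trans (ler_pM _ _ n1 n2) _ => //.
  move: Nn Nk; rewrite -[n.+1%:R^-1]/(l n) -[k.+1%:R^-1]/(l k) !ltr_pdivlMr//.
  by move: (l n) (l k) => s t; lra.
exists x0; apply: (maximal_closed _ _ _ _ xA xx0).
rewrite -[v in X in _ --> X]subr0 -(scale0r x0).
apply: cvgB; first exact: cvg_cst.
apply: cvgZ => //; exact: cvg_harmonic.
Qed.

Lemma inverse_unique x y u : A x u -> A y u -> x = y.
Proof.
move=> xu yu; apply/eqP; rewrite -subr_eq0 -normr_le0.
apply/ler_addgt0Pr => e e0; rewrite add0r.
have [d d0 gap] := uniform_gap e e0.
by apply: (gap_close _ _ _ _ _ _ e0 gap xu yu); rewrite subrr normr0 mulr0.
Qed.

Lemma inverse_unif_continuous (T : X -> X) :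
  (forall u, A (T u) u) -> unif_continuous T.
Proof.
move=> TA; rewrite /unif_continuous -!entourage_from_ballE => E [e /= e0 eE].
have e20 : 0 < e / 2 by rewrite divr_gt0.
have [d d0 gap] := uniform_gap (e / 2) e20.
exists (d / (e / 2)); first by rewrite /= divr_gt0.
move=> [u v]; rewrite -ball_normE /= => uv; apply: eE; rewrite -ball_normE /=.
apply: (@le_lt_trans _ _ (e / 2)); last by lra.
apply: (gap_close _ _ _ _ _ _ e20 gap (TA u) (TA v)).
by rewrite mulrC -ltr_pdivlMr.
Qed.

Lemma uniformly_monotone_growth_bound : growth_bound A.
Proof.
have [d d0 gap] := uniform_gap 1 ltr01.
have /choice[T TA] := surjective_pointwise.
(* The inverse satisfies [|T u - T v| <= |u - v| / d + 1]; at distance at least 2 the summand 1 is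
   absorbed by half of the left-hand side. *)
exists (d / 2), 2; split => [||[x u] [y v]]; rewrite ?divr_gt0//.
rewrite /gra /= => xu yv xy.
have -> : x = T u by exact: inverse_unique xu (TA u).
have -> : y = T v by exact: inverse_unique yv (TA v).
have := @unif_cont_large_scale _ _ _ T 1 d ler01 d0 _ u v.
rewrite mul1r => /(_ _)H.
have {}H : `|T u - T v| <= `|u - v| / d + 1.
  apply: H => w z wz.
  by apply: (gap_close _ _ _ _ _ _ ltr01 gap (TA w) (TA z)); rewrite mul1r.
have {}xy : 2 <= `|T u - T v|.
  rewrite -(inverse_unique _ _ _ xu (TA u)).
  by rewrite -(inverse_unique _ _ _ yv (TA v)).
have : `|T u - T v| / 2 <= `|u - v| / d by lra.
by rewrite ler_pdivlMr//; lra.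
Qed.

End InnerProduct.

(** * Limit form of the growth condition and conclusion *)

Lemma growth_bound_limit (R : realType) (X : completeNormedModType R)
  (A : X -> set X) : growth_bound A -> growth_limit A.
Proof.
(* The infima run over shrinking sets as [K] grows, so they increase to their supremum, possibly
   [+oo]. *)
move=> [c [K [c0 K0 cA]]]; exists (ereal_sup (range (growth_inf A))).
  apply: nondecreasing_cvge => s t st; apply: ereal_inf_le_tmp.
  by apply: image_subset => p [? ? tp]; split => //; exact: le_trans tp.
have KA : (c%:E <= growth_inf A K)%E.
  apply: le_ereal_inf_tmp => _ [[p q] /= [pA qA Kpq] <-].
  rewrite lee_fin ler_pdivlMr ?(lt_le_trans K0)//; exact: cA.
apply: (@lt_le_trans _ _ c%:E); first by rewrite lte_fin.
by apply: le_trans KA _; apply: ereal_sup_ubound; exists K.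
Qed.

Theorem theorem4p5 (R : realType) (X : completeNormedModType R)
    (dot : {dot X for idfun}%R) (A : X -> set X) :
  induces_norm dot ->
  maximally_monotone dot A ->
  uniformly_monotone dot A ->
  (growth_limit A /\ growth_bound A) /\
  surjective_op A /\
  (exists! x : X, zero_of A x) /\
  uniformly_continuous_op (inverse_op A).
Proof.
move=> dot_norm Amax Aunif.
have Abound := uniformly_monotone_growth_bound dot_norm Amax Aunif.
have Asurj := surjective_pointwise dot_norm Amax Aunif.
have Auniq := inverse_unique dot_norm Amax Aunif.
have /choice[T TA] := Asurj.
split; [split => //; exact: growth_bound_limit | split; [|split]].
- by apply/seteqP; split => // v _; have [x] := Asurj v; exists x.
- have [x x0] := Asurj 0; exists x; split => // y; exact: Auniq.
- exists T; last exact: (inverse_unif_continuous dot_norm Amax Aunif T TA).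
  move=> u; apply/seteqP; split => [x xu|_ ->]; last exact: TA.
  exact: Auniq xu (TA u).
Qed.
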